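(* (1) $A^{\Gamma,\mathrm{sym}}$ maps $\mathscr F^{\Gamma,\mathrm{sym}}$ into itself and $A^{\Gamma,\mathrm{sym}}(\mathscr F^{\Gamma,\mathrm{alt}})=0$; $A^{\Gamma,\mathrm{alt}}$ maps $\mathscr F^{\Gamma,\mathrm{alt}}$ into itself and $A^{\Gamma,\mathrm{alt}}(\mathscr F^{\Gamma,\mathrm{sym}})=0$. (2) Consequently $\mathrm{Sp}(A^\Gamma)=\mathrm{Sp}(A^{\Gamma,\mathrm{sym}}|_{\mathscr F^{\Gamma,\mathrm{sym}}})\amalg\mathrm{Sp}(A^{\Gamma,\mathrm{alt}}|_{\mathscr F^{\Gamma,\mathrm{alt}}})$ counting multiplicities, and each eigenfunction of either restriction is an eigenfunction of $A^\Gamma$ with the same eigenvalue. (3) $A^{\Gamma,\mathrm{sym}}|_{\mathscr F^{\Gamma,\mathrm{sym}}}$ is symmetric, hence diagonalizable with real spectrum; $A^{\Gamma,\mathrm{alt}}|_{\mathscr F^{\Gamma,\mathrm{alt}}}$ is antisymmetric, hence diagonalizable over $\mathbb C$ with purely imaginary spectrum. (4) Counting multiplicities, $\mathrm{Sp}(A^{\Gamma,\mathrm{sym}}|_{\mathscr F^{\Gamma,\mathrm{sym}}})=\mathrm{Sp}(A^{\underline\Gamma})$, and pulling back along $u\mapsto\underline u$ maps eigenfunctions of $A^{\underline\Gamma}$ to eigenfunctions of $A^{\Gamma,\mathrm{sym}}|_{\mathscr F^{\Gamma,\mathrm{sym}}}$ with the same eigenvalue; likewise $\mathrm{Sp}(A^{\Gamma,\mathrm{alt}}|_{\mathscr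 F^{\Gamma,\mathrm{alt}}})=\mathrm{Sp}(A^{\mathcal O(\underline\Gamma)})$, and odd extension of a function on $\mathcal O(\underline X)$ to $X$ maps eigenfunctions of $A^{\mathcal O(\underline\Gamma)}$ to eigenfunctions of $A^{\Gamma,\mathrm{alt}}|_{\mathscr F^{\Gamma,\mathrm{alt}}}$ with the same eigenvalue.
   Context: A double cover of a graded signed graph is $\Gamma=(X,E,[\cdot:\cdot],\dim,-)$: $X$ finite nonempty, $E$ directed edges ($u\subset v$), signature $[v:u]\in\{\pm1\}$, $\dim:X\to\mathbb Z$, $-$ a fixed-point-free involution, with $u\subset v\Rightarrow\dim u<\dim v$, $-u\subset v$, $u\subset-v$, $[-v:u]=[v:-u]=-[v:u]$, and $\dim(-u)=\dim u$. Quotient $\underline\Gamma$: nodes $\underline u=\{u,-u\}$, edges $\underline u\subset\underline v$ iff $u\subset v$. Leaf: no $\underline v\supset\underline u$; root: no $\underline t\subset\underline u$. $\mathrm{LP}=1$ on leaves, $\sum_{\underline v\supset\underline u}\mathrm{LP}(\underline v)$ otherwise; $\mathrm{RP}=1$ on roots, $\sum_{\underline t\subset\underline u}\mathrm{RP}(\underline t)$ otherwise. An orientation is $\mathcal O:\underline X\to X$ with $\mathcal O(\underline u)\in\{u,-u\}$. The root-to-leaf path walk on $X$ has transition matrix $P^\Gamma$: $P^\Gamma_{uu'}=\frac12\mathrm{LP}(\underline u')/\mathrm{LP}(\underline u)$ if $u\subset u'$, $[u':u]=1$; $\frac12\mathrm{RP}(\underline u')/\mathrm{RP}(\underline u)$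 if $u'\subset u$, $[u:u']=-1$; $1/4$ if $u'\in\{\pm u\}$ and $\underline u$ is exactly one of leaf/root; $1/2$ if $u'\in\{\pm u\}$ and $\underline u$ is both; $0$ otherwise. The induced walk on $\underline X$ has $P^{\underline\Gamma}_{\underline u\underline u'}=\frac12\mathrm{LP}(\underline u')/\mathrm{LP}(\underline u)$ if $\underline u\subset\underline u'$; $\frac12\mathrm{RP}(\underline u')/\mathrm{RP}(\underline u)$ if $\underline u'\subset\underline u$; $1/2$ if $\underline u=\underline u'$ exactly one of leaf/root; $1$ if both; $0$ otherwise. Let $D^\Gamma$, $D^{\underline\Gamma}$ be diagonal with entries $\mathrm{LP}(\underline u)\mathrm{RP}(\underline u)$. Set $A^\Gamma=(D^\Gamma)^{-1/2}(P^\Gamma)^T(D^\Gamma)^{1/2}$, $A^{\Gamma,\mathrm{sym}}=\frac12(A^\Gamma+(A^\Gamma)^T)$, $A^{\Gamma,\mathrm{alt}}=\frac12(A^\Gamma-(A^\Gamma)^T)$, and $A^{\underline\Gamma}=(D^{\underline\Gamma})^{1/2}P^{\underline\Gamma}(D^{\underline\Gamma})^{-1/2}$. Let $Q^{\mathrm{alt}}$ be the matrix with rows indexed by $\underline X$ (identified with $\mathcal O(\underline X)$) and columns by $X$, $Q^{\mathrm{alt}}_{\underline uu'}=1$ if $\mathcal O(\underline u)=u'$, $-1$ if $\mathcal O(\underline u)=-u'$, $0$ otherwise; $A^{\mathcal O(\underline\Gamma)}=\frac12Q^{\mathrm{alt}}A^\Gamma(Q^{\mathrm{alt}})^T$. Matrices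 act on real functions on their index sets as column vectors. $\mathscr F^{\Gamma,\mathrm{sym}}=\{f:X\to\mathbb R:f(-u)=f(u)\}$, $\mathscr F^{\Gamma,\mathrm{alt}}=\{f:f(-u)=-f(u)\}$. The odd extension of $g$ on $\mathcal O(\underline X)$ is $f(\mathcal O(\underline u))=g(\mathcal O(\underline u))$, $f(-\mathcal O(\underline u))=-g(\mathcal O(\underline u))$. *)

(* Defs.v *)
From HB Require Import structures.
From mathcomp Require Import all_boot all_order all_algebra.
From mathcomp Require Import complex reals.

Set Implicit Arguments.
Unset Strict Implicit.
Unset Printing Implicit Defensive.

Import Order.TTheory GRing.Theory Num.Theory.
Local Open Scope ring_scope.

(* [dc_edge u v] is u ⊂ v and [dc_sign v u] is [v:u]; the value of [dc_sign]
   outside the edges carries no information and is never used. *)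
Record doubleCover := DoubleCover {
  dc_node :> finType;
  dc_edge : rel dc_node;
  dc_sign : dc_node -> dc_node -> int;
  dc_dim : dc_node -> int;
  dc_neg : dc_node -> dc_node;
  dc_nonempty : (0 < #|dc_node|)%N;
  dc_signP : forall u v, dc_edge u v -> dc_sign v u = 1 \/ dc_sign v u = -1;
  dc_negK : involutive dc_neg;
  dc_neg_neq : forall u, dc_neg u != u;
  dc_edge_dim : forall u v, dc_edge u v -> dc_dim u < dc_dim v;
  dc_edge_negl : forall u v, dc_edge u v -> dc_edge (dc_neg u) v;
  dc_edge_negr : forall u v, dc_edge u v -> dc_edge u (dc_neg v);
  dc_sign_negl : forall u v, dc_edge u v -> dc_sign (dc_neg v) u = - dc_sign v u;
  dc_sign_negr : forall u v, dc_edge u v -> dc_sign v (dc_neg u) = - dc_sign v u;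
  dc_dim_neg : forall u, dc_dim (dc_neg u) = dc_dim u
}.

Section Quotient.
Variable G : doubleCover.
Implicit Types u v : G.

Definition pm u : {set G} := [set u; dc_neg u].

Definition qnode : finType := {p : {set G} | p \in [set pm u | u : G]}.

Definition cls u : qnode := exist _ (pm u) (imset_f pm (isT : u \in predT)).

(* By the edge axioms this does not depend on the representatives; see
   [qedge_cls]. *)
Definition qedge (p q : qnode) : bool :=
  [exists u in val p, exists v in val q, dc_edge u v].

Definition is_leaf (p : qnode) : bool := ~~ [exists q, qedge p q].
Definition is_root (p : qnode) : bool := ~~ [exists q, qedge q p].

Lemma clsP (p : qnode) : exists u, p = cls u.
Proof.
case: p => p hp; have /imsetP[u _ e] := hp.
by exists u; apply: val_inj.
Qed.

Lemma cls_neg u : cls (dc_neg u) = cls u.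
Proof. by apply: val_inj; rewrite /= /pm dc_negK setUC. Qed.

Lemma qedge_cls u v : qedge (cls u) (cls v) = dc_edge u v.
Proof.
have negl a b : dc_edge (dc_neg a) b = dc_edge a b.
  by apply/idP/idP => /dc_edge_negl //; rewrite dc_negK.
have negr a b : dc_edge a (dc_neg b) = dc_edge a b.
  by apply/idP/idP => /dc_edge_negr //; rewrite dc_negK.
apply/idP/idP => [/exists_inP[a /set2P ha /exists_inP[b /set2P hb]]|e].
  by case: ha => ->; case: hb => ->; rewrite ?negl ?negr.
by apply/exists_inP; exists u; rewrite ?set21 //; apply/exists_inP; exists v;
  rewrite ?set21.
Qed.

End Quotient.

(* [npaths e n x] unfolds n times the recursion
   N(x) = 1 if x has no e-successor, N(x) = \sum_(y | e x y) N(y) otherwise. *)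
Fixpoint npaths (T : finType) (e : rel T) (n : nat) (x : T) : nat :=
  if n is m.+1 then
    if [exists y, e x y] then (\sum_(y | e x y) npaths e m y)%N else 1%N
  else 1%N.

(* In a graded graph, #|T| unfoldings reach the fixpoint. *)
Lemma npathsE (T : finType) (e : rel T) (rk : T -> int) (x : T) :
  (forall x y, e x y -> rk x < rk y) ->
  npaths e #|T| x =
  if [exists y, e x y] then (\sum_(y | e x y) npaths e #|T| y)%N else 1%N.
Proof.
move=> erk; pose m x := #|[set y | rk x < rk y]|.
have me a b : e a b -> (m b < m a)%N.
  move=> /erk ab; apply: proper_card; apply/properP; split.
    by apply/subsetP => c; rewrite !inE; apply: lt_trans.
  by exists b; rewrite !inE // ltxx.
have stable n1 : forall n2 a, (m a < n1)%N -> (m a < n2)%N ->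
    npaths e n1 a = npaths e n2 a.
  elim: n1 => // n1 IH [//|n2] a; rewrite !ltnS => h1 h2 /=.
  case: ifP => // _; apply: eq_bigr => b /me mb.
  by apply: IH; apply: leq_trans mb _.
have mT a : (m a < #|T|)%N.
  rewrite -cardsT; apply: proper_card; apply/properP.
  by split; [exact: subsetT | exists a; rewrite !inE ?ltxx].
rewrite (stable _ #|T|.+1) ?mT //=; exact: leqW (mT x).
Qed.

Section Paths.
Variable G : doubleCover.
Implicit Type p : qnode G.

Definition LP p : nat := npaths (@qedge G) #|qnode G| p.
Definition RP p : nat := npaths (fun q r => qedge r q) #|qnode G| p.

Let rk p : int := \sum_(u in val p) dc_dim u.

Let rk_edge p q : qedge p q -> rk p < rk q.
Proof.
have rkE (w : G) : rk (cls w) = dc_dim w + dc_dim w.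
  rewrite /rk /= /pm big_setU1 ?inE; last by rewrite eq_sym dc_neg_neq.
  by rewrite big_set1 dc_dim_neg.
have [u ->] := clsP p; have [v ->] := clsP q.
by rewrite qedge_cls !rkE => /dc_edge_dim h; apply: ltrD.
Qed.

Lemma LP_rec p :
  LP p = if is_leaf p then 1%N else (\sum_(q | qedge p q) LP q)%N.
Proof. by rewrite /LP (npathsE _ rk_edge) /is_leaf; case: ifP. Qed.

Lemma RP_rec p :
  RP p = if is_root p then 1%N else (\sum_(q | qedge q p) RP q)%N.
Proof.
have h q r : qedge r q -> - rk q < - rk r by move=> /rk_edge; rewrite ltrN2.
by rewrite /RP (npathsE _ h) /is_root; case: ifP.
Qed.

End Paths.

(* Functions and matrices indexed by a finite type T are column vectors and
   matrices over 'I_#|T| through the enumeration of T. *)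
Section FiniteIndex.
Variables (K : Type) (S T : finType).

Definition mx_of (F : S -> T -> K) : 'M[K]_(#|S|, #|T|) :=
  \matrix_(i, j) F (enum_val i) (enum_val j).
Definition col_of (f : T -> K) : 'cV[K]_#|T| := \col_i f (enum_val i).
Definition at_ (f : 'cV[K]_#|T|) (u : T) : K := f (enum_rank u) 0.

Lemma at_col_of f u : at_ (col_of f) u = f u.
Proof. by rewrite /at_ mxE enum_rankK. Qed.

End FiniteIndex.

Section Walks.
Variables (R : realType) (G : doubleCover).

Definition PG : 'M[R]_#|G| := mx_of (fun u u' : G =>
  if dc_edge u u' && (dc_sign u' u == 1)
  then 2^-1 * ((LP (cls u'))%:R / (LP (cls u))%:R)
  else if dc_edge u' u && (dc_sign u u' == -1)
  then 2^-1 * ((RP (cls u'))%:R / (RP (cls u))%:R)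
  else if (u' == u) || (u' == dc_neg u) then
    if is_leaf (cls u) && is_root (cls u) then 2^-1
    else if is_leaf (cls u) || is_root (cls u) then 4^-1
    else 0
  else 0).

Definition PQ : 'M[R]_#|qnode G| := mx_of (fun p p' : qnode G =>
  if qedge p p' then 2^-1 * ((LP p')%:R / (LP p)%:R)
  else if qedge p' p then 2^-1 * ((RP p')%:R / (RP p)%:R)
  else if p == p' then
    if is_leaf p && is_root p then 1
    else if is_leaf p || is_root p then 2^-1
    else 0
  else 0).

Definition DG : 'M[R]_#|G| := mx_of (fun u u' : G =>
  if u == u' then (LP (cls u) * RP (cls u))%:R else 0).
Definition DQ : 'M[R]_#|qnode G| := mx_of (fun p p' : qnode G =>
  if p == p' then (LP p * RP p)%:R else 0).

(* The square root of a nonnegative diagonal matrix, taken entrywise. *)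
Definition dsqrt n (D : 'M[R]_n) : 'M[R]_n := map_mx Num.sqrt D.

Definition AG : 'M[R]_#|G| := invmx (dsqrt DG) *m PG^T *m dsqrt DG.
Definition AGsym : 'M[R]_#|G| := 2^-1 *: (AG + AG^T).
Definition AGalt : 'M[R]_#|G| := 2^-1 *: (AG - AG^T).
Definition AQ : 'M[R]_#|qnode G| := dsqrt DQ *m PQ *m invmx (dsqrt DQ).

Definition is_orientation (O : qnode G -> G) : Prop := forall p, O p \in val p.

Definition Qalt (O : qnode G -> G) : 'M[R]_(#|qnode G|, #|G|) :=
  mx_of (fun (p : qnode G) (u' : G) =>
    if O p == u' then 1 else if O p == dc_neg u' then -1 else 0).

Definition AO (O : qnode G -> G) : 'M[R]_#|qnode G| :=
  2^-1 *: (Qalt O *m AG *m (Qalt O)^T).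

End Walks.

Section FunctionSpaces.
Variables (K : fieldType) (G : doubleCover).
Implicit Type f : 'cV[K]_#|G|.

Definition negmx : 'M[K]_#|G| :=
  mx_of (fun u v : G => if v == dc_neg u then 1 else 0).

(* [negmx] is f |-> f \o dc_neg; both spaces are described pointwise by
   [Fsym_P] and [Falt_P]. *)
Definition Fsym : {vspace 'cV[K]_#|G|} := lker (linfun (mulmx (negmx - 1%:M))).
Definition Falt : {vspace 'cV[K]_#|G|} := lker (linfun (mulmx (negmx + 1%:M))).

Lemma at_negmx f (u : G) : at_ (negmx *m f) u = at_ f (dc_neg u).
Proof.
rewrite /at_ mxE (bigD1 (enum_rank (dc_neg u))) //= mxE !enum_rankK eqxx mul1r.
rewrite big1 ?addr0 // => i ne; rewrite mxE enum_rankK.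
case: eqP => [e|]; last by rewrite mul0r.
by rewrite -e enum_valK eqxx in ne.
Qed.

Lemma Fsym_P f :
  reflect (forall u : G, at_ f (dc_neg u) = at_ f u) (f \in Fsym).
Proof.
rewrite memv_ker lfunE /= mulmxBl mul1mx subr_eq0; apply: (iffP eqP) => [e u|e].
  by rewrite -at_negmx e.
apply/colP => i; have := at_negmx f (enum_val i).
by rewrite e /at_ !enum_valK.
Qed.

Lemma Falt_P f :
  reflect (forall u : G, at_ f (dc_neg u) = - at_ f u) (f \in Falt).
Proof.
rewrite memv_ker lfunE /= mulmxDl mul1mx addr_eq0; apply: (iffP eqP) => [e u|e].
  by rewrite -at_negmx e /at_ mxE.
apply/colP => i; have := at_negmx f (enum_val i).
by rewrite e /at_ !enum_valK => ->; rewrite [RHS]mxE.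
Qed.

Definition pullback (g : 'cV[K]_#|qnode G|) : 'cV[K]_#|G| :=
  col_of (fun u : G => at_ g (cls u)).

(* g on O(X/±) is stored as the function p |-> g (O p) on X/±. *)
Definition odd_ext (O : qnode G -> G) (g : 'cV[K]_#|qnode G|) : 'cV[K]_#|G| :=
  col_of (fun u : G => if u == O (cls u) then at_ g (cls u)
                       else - at_ g (cls u)).

End FunctionSpaces.

(* The matrix, in the basis [vbasis U], of the restriction of f |-> A *m f to
   a subspace U which it maps into itself. *)
Definition restr (K : fieldType) n (A : 'M[K]_n) (U : {vspace 'cV[K]_n}) :
    'M[K]_(\dim U) :=
  \matrix_(i, j) coord (vbasis U) i (A *m (vbasis U)`_j).

Definition cplx (R : realType) m n (A : 'M[R]_(m, n)) : 'M[R[i]]_(m, n) :=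
  map_mx (real_complex R) A.

(* The complex spectrum: the roots of the characteristic polynomial listed
   with multiplicity, a multiset when considered up to [perm_eq]. *)
Definition Sp (R : realType) n (A : 'M[R]_n) : seq R[i] :=
  sval (closed_field_poly_normal (char_poly (cplx A))).

Lemma SpE (R : realType) n (A : 'M[R]_n) :
  char_poly (cplx A) = \prod_(z <- Sp A) ('X - z%:P).
Proof.
rewrite /Sp; case: closed_field_poly_normal => r /= {1}->.
by rewrite (monicP (char_poly_monic _)) scale1r.
Qed.

Definition eigenfun (K : fieldType) n (A : 'M[K]_n) (l : K) (f : 'cV[K]_n) :
    Prop :=
  f != 0 /\ A *m f = l *: f.

Definition dot (K : fieldType) n (f g : 'cV[K]_n) : K := \sum_i f i 0 * g i 0.

(* Main.v *)
Require Import Defs.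
From HB Require Import structures.
From mathcomp Require Import all_boot all_order all_algebra.
From mathcomp Require Import complex reals spectral ring.
Import Order.TTheory GRing.Theory Num.Theory.
Local Open Scope ring_scope.

Set Implicit Arguments.
Unset Strict Implicit.
Unset Printing Implicit Defensive.

(* Write A for [AG] and N for the involution f |-> f o (-). Reversing an edge
   exchanges the two cases of the walk, exactly as changing the sign of one end
   does, and after the conjugation by D^(1/2) both cases carry the same weight;
   hence A^T = N A = A N. So [AGsym] and [AGalt] are A (1 + N) / 2 and
   A (1 - N) / 2, the compositions of A with the projections onto the even and
   odd functions. With M the matrix of the pullback (resp. of the odd extension)
   one has M^T M = 2 and M M^T = 1 + N (resp. 1 - N), so that A M = M B with
   B = M^T A M / 2; this B is [AQ] (resp. [AO]). Both restrictions are therefore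
   similar to B, which is real and symmetric (resp. antisymmetric). *)

(** * Similarity between matrices of propositionally equal sizes, and restriction to a subspace *)

Section Similarity.
Variable K : fieldType.

(* The sizes [n] and [k] are equal as soon as the two matrices are similar,
   but in general not convertible. *)
Definition mxsim n k (A : 'M[K]_n) (B : 'M[K]_k) : Prop :=
  exists (S : 'M[K]_(n, k)) (T : 'M[K]_(k, n)),
    [/\ S *m T = 1%:M, T *m S = 1%:M & A *m S = S *m B].

(** Each one-sided inverse bounds one size by the other. Once the sizes are identified, the cast
    becomes the identity and results on square matrices apply. *)
Lemma mxsim_unit n k (A : 'M[K]_n) (B : 'M[K]_k) : mxsim A B ->
  exists e : k = n, exists2 S : 'M[K]_n,
    S \in unitmx & A *m S = S *m castmx (e, e) B.
Proof.
case=> S [T [ST TS AS]].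
have e : k = n.
  by apply/eqP; rewrite eqn_leq (mulmx1_min ST) (mulmx1_min TS).
case: n / e A S T ST TS AS => A S T ST _ AS; exists erefl.
by exists S => //; case/mulmx1_unit: ST.
Qed.

Lemma mxsim_char_poly n k (A : 'M[K]_n) (B : 'M[K]_k) :
  mxsim A B -> char_poly A = char_poly B.
Proof.
case/mxsim_unit => e; case: n / e A => A [S uS]; rewrite castmx_id => AS.
pose SX := map_mx polyC S.
have uSX : \det SX != 0.
  by rewrite det_map_mx polyC_eq0 -unitfE -unitmxE.
apply: (mulIf uSX); rewrite -det_mulmx /char_poly mulrC -det_mulmx.
congr (\det _); rewrite /char_poly_mx mulmxBl mulmxBr -!map_mxM AS.
by rewrite scalar_mxC.
Qed.

Lemma mxsim_diagonalizable n k (A : 'M[K]_n) (B : 'M[K]_k) :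
  mxsim A B -> mxpoly.diagonalizable B -> mxpoly.diagonalizable A.
Proof.
case/mxsim_unit => e; case: n / e A => A [S uS]; rewrite castmx_id => AS.
case=> P uP /diagonalizable_forPex [D /(simmxP uP) PB].
(* In the row convention, P B = D P and A S = S B give (P S^-1) A = D (P S^-1). *)
have uPS : P *m invmx S \in unitmx by rewrite unitmx_mul uP unitmx_inv.
exists (P *m invmx S) => //; apply/diagonalizable_forPex; exists D.
apply/(simmxP uPS); rewrite mulmxA -PB -!mulmxA; congr (_ *m _).
by apply: (can_inj (mulKmx uS)); rewrite mulKVmx // mulmxA -AS mulmxK.
Qed.

Lemma char_poly_block_diag n k (A : 'M[K]_n) (B : 'M[K]_k) :
  char_poly (block_mx A 0 0 B) = char_poly A * char_poly B.
Proof. rewrite /char_poly char_block_diag_mx; exact: det_ublock. Qed.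

(* The columns of [M] form a basis of [U], with coordinate map [L]. *)
Lemma mxsim_restr n k (A : 'M[K]_n) (B : 'M[K]_k) (U : {vspace 'cV[K]_n})
    (M : 'M[K]_(n, k)) (L : 'M[K]_(k, n)) :
  L *m M = 1%:M -> A *m M = M *m B ->
  (forall f, (f \in U) = (M *m (L *m f) == f)) -> mxsim (restr A U) B.
Proof.
move=> LM AM UE.
pose V : 'M[K]_(n, \dim U) := \matrix_(i, j) (vbasis U)`_j i 0.
have VE (j : 'I_(\dim U)) : col j V = (vbasis U)`_j by apply/colP => i; rewrite !mxE.
have VU (j : 'I_(\dim U)) : (vbasis U)`_j \in U.
  by apply: vbasis_mem; rewrite mem_nth ?size_tuple.
pose cf (f : 'cV[K]_n) : 'cV[K]_(\dim U) := \col_i coord (vbasis U) i f.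
have cfE f : f \in U -> V *m cf f = f.
  move=> fU; rewrite {2}(coord_vbasis fU); apply/colP => i.
  rewrite mxE summxE; apply: eq_bigr => j _.
  by rewrite !mxE mulrC.
have MU g : M *m g \in U by rewrite UE (mulmxA L) LM mul1mx.
have stab f : f \in U -> A *m f \in U.
  by rewrite UE => /eqP <-; rewrite mulmxA AM -mulmxA MU.
(* The columns of [V] are a basis, so [V] cancels on the left; equations on coordinates can then be
   checked in the ambient space. *)
have Vinj m (X Y : 'M[K]_(_, m)) : V *m X = V *m Y -> X = Y.
  move=> e; apply/matrixP => i j.
  have fV : free (vbasis U) by exact: (basis_free (vbasisP U)).
  have E Z : \sum_(l < \dim U) (Z : 'M[K]_(_, m)) l j *: (vbasis U)`_l
      = col j (V *m Z).
    apply/colP => r; rewrite summxE !mxE; apply: eq_bigr => l _.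
    by rewrite !mxE mulrC.
  have := coord_sum_free (X^~ j) i fV; rewrite E e -E => <-.
  exact: coord_sum_free.
pose S : 'M[K]_(\dim U, k) := \matrix_(i, j) cf (col j M) i 0.
have VS : V *m S = M.
  apply/matrixP => i j.
  have -> : (V *m S) i j = (V *m cf (col j M)) i 0.
    by rewrite !mxE; apply: eq_bigr => l _; rewrite !mxE.
  by rewrite cfE ?mxE // colE MU.
have VR : V *m restr A U = A *m V.
  apply/matrixP => i j.
  have -> : (V *m restr A U) i j = (V *m cf (A *m (vbasis U)`_j)) i 0.
    by rewrite !mxE; apply: eq_bigr => l _; rewrite !mxE.
  by rewrite cfE ?stab // -VE colE mulmxA -colE mxE.
have MLV : M *m (L *m V) = V.
  apply/matrixP => i j; have := VU j; rewrite UE -VE => /eqP.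
  by rewrite colE !mulmxA -colE => /colP /(_ i); rewrite -mulmxA -colE !mxE.
(* [S] holds the coordinates of the columns of [M]. The first and third equations are checked after
   multiplying by [V]; the second is L V S = L M = 1. *)
exists S, (L *m V); split.
- by apply: Vinj; rewrite mulmxA VS MLV mulmx1.
- by rewrite -mulmxA VS.
- by apply: Vinj; rewrite mulmxA VR -mulmxA VS AM mulmxA VS.
Qed.

End Similarity.

(** * Complex spectra of real symmetric and antisymmetric matrices *)

Section RealSpectrum.
Variable R : realType.

Lemma cplxM m n k (A : 'M[R]_(m, n)) (B : 'M[R]_(n, k)) :
  cplx (A *m B) = cplx A *m cplx B.
Proof. exact: map_mxM. Qed.

Lemma mxsim_cplx n k (A : 'M[R]_n) (B : 'M[R]_k) :
  mxsim A B -> mxsim (cplx A) (cplx B).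
Proof.
case=> S [T [ST TS AS]]; exists (cplx S), (cplx T).
by rewrite -!cplxM ST TS AS /cplx !map_scalar_mx rmorph1.
Qed.

Lemma Sp_perm_eq n k (A : 'M[R]_n) (B : 'M[R]_k) :
  char_poly A = char_poly B -> perm_eq (Sp A) (Sp B).
Proof. by move=> e; apply: prod_XsubC_eq; rewrite -!SpE -!map_char_poly e. Qed.

Lemma Sp_cat n k l (A : 'M[R]_n) (B : 'M[R]_k) (C : 'M[R]_l) :
  char_poly A = char_poly B * char_poly C -> perm_eq (Sp A) (Sp B ++ Sp C).
Proof.
move=> e; apply: prod_XsubC_eq; rewrite big_cat -!SpE -!map_char_poly e.
exact: rmorphM.
Qed.

Lemma mem_Sp n (A : 'M[R]_n) l : (l \in Sp A) = eigenvalue (cplx A) l.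
Proof. by rewrite eigenvalue_root_char SpE root_prod_XsubC. Qed.


Lemma conj_cplx m n (A : 'M[R]_(m, n)) : map_mx Num.conj (cplx A) = cplx A.
Proof. by apply/matrixP => i j; rewrite !mxE; exact: conjc_real. Qed.

Lemma cplx_sgn_tr n (b : bool) (A : 'M[R]_n) :
  A^T = (-1) ^+ b *: A -> (cplx A)^T = (-1) ^+ b *: cplx A.
Proof. by move=> At; rewrite /cplx map_trmx At map_mxZ rmorph_sign. Qed.

(** For a real matrix the adjoint is the transpose, here plus or minus the matrix itself; so the
    matrix is normal and the spectral theorem applies. The bit [b] treats both symmetry types at
    once. *)
Lemma sgn_sym_diagonalizable n (b : bool) (A : 'M[R]_n) :
  A^T = (-1) ^+ b *: A -> mxpoly.diagonalizable (cplx A).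
Proof.
move=> /cplx_sgn_tr tA.
have /orthomx_spectralP AE : cplx A \is normalmx.
  apply/normalmxP; rewrite tA map_mxZ conj_cplx.
  by rewrite -scalemxAr -scalemxAl.
exists (spectralmx (cplx A)); first exact: spectral_unit.
apply/diagonalizable_forPex; exists (spectral_diag (cplx A)).
apply/simmxP; first exact: spectral_unit.
by rewrite {2}AE -!mulmxA mulKVmx // spectral_unit.
Qed.

(* If [v A = l v], then [v A v^*] equals both [l |v|^2] and, moving [A] to the
   right factor, [(-1)^b conj(l) |v|^2]. *)
Lemma sgn_sym_eigenvalue n (b : bool) (A : 'M[R]_n) (l : R[i]) :
  A^T = (-1) ^+ b *: A -> eigenvalue (cplx A) l -> l^*%R = (-1) ^+ b * l.
Proof.
move=> /cplx_sgn_tr tA /eigenvalueP[v vA vn0].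
pose w : 'cV[R[i]]_n := map_mx Num.conj v^T.
(* This is the conjugate transpose of v A = l v. *)
have Aw : (-1) ^+ b *: (cplx A *m w) = l^*%R *: w.
  rewrite scalemxAl -tA -[cplx A]conj_cplx map_trmx -map_mxM -trmx_mul vA.
  by apply/colP => i; rewrite !mxE rmorphM.
pose q : R[i] := (v *m w) 0 0.
have qn0 : q != 0.
  have qE : q = \sum_i `|v 0 i| ^+ 2.
    by rewrite /q mxE; apply: eq_bigr => i _; rewrite !mxE normCK.
  rewrite qE psumr_neq0; last by move=> i _; rewrite exprn_ge0.
  have [i vi] : exists i, v 0 i != 0.
    apply/existsP; apply: contraNT vn0; rewrite negb_exists => /forallP v0.
    by apply/eqP/rowP => i; rewrite mxE; apply/eqP; have := v0 i; rewrite negbK.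
  by apply/hasP; exists i; rewrite ?mem_index_enum // exprn_gt0 ?normr_gt0.
apply: (mulIf qn0).
have := congr1 (fun X => (v *m X) 0 0) Aw.
rewrite -!scalemxAr mulmxA vA -scalemxAl scalerA [X in X = _]mxE [X in _ = X]mxE.
by move=> ->.
Qed.

Lemma conjC_Im0 (l : R[i]) : l^*%R = l -> complex.Im l = 0.
Proof.
case: l => x y [] /eqP.
by rewrite -subr_eq0 -opprD oppr_eq0 -mulr2n mulrn_eq0 => /eqP.
Qed.

Lemma conjC_Re0 (l : R[i]) : l^*%R = - l -> complex.Re l = 0.
Proof. by case: l => x y [] /eqP; rewrite -addr_eq0 -mulr2n mulrn_eq0 => /eqP. Qed.

(** Over the complex numbers the minimal polynomial is a product of distinct linear factors, and its
    roots are real. Divisibility descends along the field extension, so the real minimal polynomial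
    also splits with simple roots. *)
Lemma symmetric_diagonalizable n (A : 'M[R]_n) :
  A^T = A -> mxpoly.diagonalizable A.
Proof.
case: n A => [|n] A At.
  by rewrite (flatmx0 A); exact: diagonalizable0.
have At1 : A^T = (-1) ^+ false *: A by rewrite scale1r.
have [P uP dP] := sgn_sym_diagonalizable At1.
have := diagonalizable_for_mxminpoly uP dP.
set rs := undup _ => minE.
have rs_real r : r \in rs -> r = real_complex R (complex.Re r).
  rewrite -root_prod_XsubC -minE -eigenvalue_root_min.
  move=> /(sgn_sym_eigenvalue At1); rewrite mul1r => /conjC_Im0.
  by case: r => x y /= ->.
apply/diagonalizableP; exists (map (@complex.Re R) rs).
  by rewrite map_inj_in_uniq ?undup_uniq // => x y /rs_real -> /rs_real -> /= ->.
rewrite -(dvdp_map (real_complex R)) -mxminpoly_map -/(cplx A) minE.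
rewrite map_prod_XsubC big_map.
by rewrite (eq_big_seq (fun r => 'X - (real_complex R (complex.Re r))%:P))
  // => r /rs_real <-.
Qed.

End RealSpectrum.

(** * Matrix calculus over finite index types *)

Section FiniteIndexMatrices.
Variable K : fieldType.

Lemma eq_mx_of (S T : finType) (F H : S -> T -> K) :
  (forall s t, F s t = H s t) -> mx_of F = mx_of H.
Proof. by move=> e; apply/matrixP => i j; rewrite !mxE. Qed.

Lemma tr_mx_of (S T : finType) (F : S -> T -> K) :
  (mx_of F)^T = mx_of (fun t s => F s t).
Proof. by apply/matrixP => i j; rewrite !mxE. Qed.

Lemma mulmx_of (S T V : finType) (F : S -> T -> K) (H : T -> V -> K) :
  mx_of F *m mx_of H = mx_of (fun s v => \sum_t F s t * H t v).
Proof.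
apply/matrixP => i j; rewrite !mxE (reindex (@enum_val T T)) /=; last first.
  exact/onW_bij/enum_val_bij.
by apply: eq_bigr => l _; rewrite !mxE.
Qed.

Lemma mulmx_col_of (S T : finType) (F : S -> T -> K) (f : 'cV[K]_#|T|) :
  mx_of F *m f = col_of (fun s => \sum_t F s t * at_ f t).
Proof.
apply/colP => i; rewrite !mxE (reindex (@enum_val T T)) /=; last first.
  exact/onW_bij/enum_val_bij.
by apply: eq_bigr => l _; rewrite !mxE /at_ enum_valK.
Qed.

Lemma mx_of_diag (T : finType) (d : T -> K) :
  mx_of (fun s t => if s == t then d s else 0) = diag_mx (\row_i d (enum_val i)).
Proof.
apply/matrixP => i j; rewrite !mxE (inj_eq enum_val_inj).
by case: eqP => [->|]; rewrite ?mulr1n ?mulr0n.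
Qed.

Lemma mx_of1 (T : finType) :
  mx_of (fun s t : T => if s == t then 1 else 0) = 1%:M :> 'M[K]_#|T|.
Proof.
by apply/matrixP => i j; rewrite !mxE (inj_eq enum_val_inj); case: eqP.
Qed.

Lemma invmx_diag_mx_of (T : finType) (d : T -> K) :
  (forall t, d t != 0) ->
  invmx (mx_of (fun s t => if s == t then d s else 0)) =
  mx_of (fun s t => if s == t then (d s)^-1 else 0).
Proof.
move=> dn0; rewrite !mx_of_diag.
have DV : diag_mx (\row_i d (enum_val i)) *m
    diag_mx (\row_i (d (enum_val i))^-1) = 1%:M :> 'M[K]_#|T|.
  rewrite mulmx_diag -diag_const_mx; congr diag_mx.
  by apply/rowP => i; rewrite !mxE divff.
have [uD _] := mulmx1_unit DV.
by apply: (can_inj (mulKmx uD)); rewrite DV mulmxV.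
Qed.

Lemma mulmx_diag_of (T : finType) (d e : T -> K) (F : T -> T -> K) :
  mx_of (fun s t => if s == t then d s else 0) *m mx_of F *m
  mx_of (fun s t => if s == t then e s else 0) =
  mx_of (fun s t => d s * F s t * e t).
Proof.
rewrite !mx_of_diag mul_diag_mx mul_mx_diag.
by apply/matrixP => i j; rewrite !mxE.
Qed.

End FiniteIndexMatrices.

(** * Edges, classes and path counts of a double cover *)

Section CoverCombinatorics.
Variable G : doubleCover.
Implicit Types (u v : G) (p q : qnode G).

Lemma edge_negl u v : dc_edge (dc_neg u) v = dc_edge u v.
Proof. by apply/idP/idP => /dc_edge_negl //; rewrite dc_negK. Qed.

Lemma edge_negr u v : dc_edge u (dc_neg v) = dc_edge u v.
Proof. by apply/idP/idP => /dc_edge_negr //; rewrite dc_negK. Qed.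

Lemma edge_asym u v : dc_edge u v -> dc_edge v u = false.
Proof.
move=> /dc_edge_dim uv; apply/negP => /dc_edge_dim vu.
by have := lt_trans uv vu; rewrite ltxx.
Qed.

Lemma edge_irr u : dc_edge u u = false.
Proof. by apply/negP => e; have := edge_asym e; rewrite e. Qed.

Lemma neg_inj : injective (@dc_neg G).
Proof. exact: inv_inj (@dc_negK G). Qed.

Lemma eq_neg u v : (u == dc_neg v) = (dc_neg u == v).
Proof. by rewrite -(inj_eq neg_inj) dc_negK. Qed.

Lemma cls_eq u v : (cls u == cls v) = (u == v) || (u == dc_neg v).
Proof.
apply/eqP/orP => [/(congr1 val) /= e|[] /eqP -> //]; last exact: cls_neg.
by have := set21 u (dc_neg u); rewrite -/(pm u) e => /set2P[] ->; [left|right].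
Qed.

Lemma mem_cls u p : (u \in val p) = (cls u == p).
Proof.
have [v ->] := clsP p; rewrite cls_eq /=.
by apply/set2P/orP => [] [] /eqP; [left|right|left|right].
Qed.

Lemma sum_cls (K : fieldType) (F : G -> K) v :
  \sum_(u | cls u == cls v) F u = F v + F (dc_neg v).
Proof.
rewrite (bigD1 v) //= (bigD1 (dc_neg v)) /=; last first.
  by rewrite cls_neg eqxx dc_neg_neq.
rewrite big1 ?addr0 // => u /andP[/andP[]].
by rewrite cls_eq => /orP[] ->.
Qed.

Lemma npaths_gt0 (T : finType) (e : rel T) n x : (0 < npaths e n x)%N.
Proof.
elim: n x => //= n IH x; case: ifP => // /existsP[y exy].
by rewrite (bigD1 y) //= addn_gt0 IH.
Qed.

Lemma LP_gt0 p : (0 < LP p)%N. Proof. exact: npaths_gt0. Qed.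
Lemma RP_gt0 p : (0 < RP p)%N. Proof. exact: npaths_gt0. Qed.

End CoverCombinatorics.

(** * Explicit entries of the conjugated transition matrices *)

Section Entries.
Variables (R : realType) (G : doubleCover).
Implicit Types (u v : G) (p q : qnode G).

Let lp p : R := Num.sqrt (LP p)%:R.
Let rp p : R := Num.sqrt (RP p)%:R.

(** For p ⊂ q, the upward probability (through LP) and the downward one (through RP) both become 1/2
    sqrt(LP(q) RP(p) / (LP(p) RP(q))) after conjugation by D^(1/2). *)
Definition edge_weight p q : R := 2^-1 * (lp q * rp p / (lp p * rp q)).

Definition loop_weight p : R :=
  if is_leaf p && is_root p then 2^-1
  else if is_leaf p || is_root p then 4^-1 else 0.

Let lp_gt0 p : 0 < lp p. Proof. by rewrite sqrtr_gt0 ltr0n LP_gt0. Qed.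
Let rp_gt0 p : 0 < rp p. Proof. by rewrite sqrtr_gt0 ltr0n RP_gt0. Qed.
Let lp_sqr p : (LP p)%:R = lp p ^+ 2 :> R. Proof. by rewrite sqr_sqrtr. Qed.
Let rp_sqr p : (RP p)%:R = rp p ^+ 2 :> R. Proof. by rewrite sqr_sqrtr. Qed.

Let sqrt_weight p : Num.sqrt ((LP p * RP p)%:R : R) = lp p * rp p.
Proof. by rewrite natrM sqrtrM. Qed.

Let weight_neq0 p : lp p * rp p != 0.
Proof. by rewrite mulf_neq0 ?gt_eqF. Qed.

(** Because of the transpose in [AG], this is the weight of the step from [v] to [u]; hence the
    upward case is v ⊂ u. *)
Definition AG_entry u v : R :=
  if dc_edge v u && (dc_sign u v == 1) then edge_weight (cls v) (cls u)
  else if dc_edge u v && (dc_sign v u == -1) then edge_weight (cls u) (cls v)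
  else if cls u == cls v then loop_weight (cls u) else 0.

(** The loop weight is doubled since the steps from [u] to [u] and to [-u] merge in the quotient. *)
Definition AQ_entry p q : R :=
  if qedge p q then edge_weight p q
  else if qedge q p then edge_weight q p
  else if p == q then loop_weight p + loop_weight p else 0.

Lemma dsqrt_diag (T : finType) (d e : T -> R) :
  (forall t, Num.sqrt (d t) = e t) ->
  dsqrt (mx_of (fun s t => if s == t then d s else 0)) =
  mx_of (fun s t => if s == t then e s else 0).
Proof.
by move=> de; apply/matrixP => i j; rewrite !mxE; case: eqP; rewrite ?sqrtr0.
Qed.

Lemma AGE : AG R G = mx_of AG_entry.
Proof.
rewrite /AG /DG (dsqrt_diag (fun u => sqrt_weight (cls u))) /PG tr_mx_of.
rewrite invmx_diag_mx_of => [|u]; last exact: weight_neq0.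
rewrite mulmx_diag_of.
apply: eq_mx_of => u v; rewrite /AG_entry /edge_weight.
have [lu lv ru rv] := And4 (lt0r_neq0 (lp_gt0 (cls u)))
  (lt0r_neq0 (lp_gt0 (cls v))) (lt0r_neq0 (rp_gt0 (cls u)))
  (lt0r_neq0 (rp_gt0 (cls v))).
case: ifP => _; first by rewrite !lp_sqr; field; rewrite ?lu ?lv ?ru ?rv.
case: ifP => _; first by rewrite !rp_sqr; field; rewrite ?lu ?lv ?ru ?rv.
(* A loop stays within one class, where the two conjugating factors cancel. *)
rewrite -cls_eq; case: eqP => [->|]; last by rewrite mulr0 mul0r.
by rewrite mulrAC mulVf ?mul1r.
Qed.

Lemma AQE : AQ R G = mx_of AQ_entry.
Proof.
rewrite /AQ /DQ (dsqrt_diag sqrt_weight) /PQ.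
rewrite invmx_diag_mx_of // mulmx_diag_of.
apply: eq_mx_of => p q; rewrite /AQ_entry /edge_weight.
have [lu lv ru rv] := And4 (lt0r_neq0 (lp_gt0 p))
  (lt0r_neq0 (lp_gt0 q)) (lt0r_neq0 (rp_gt0 p)) (lt0r_neq0 (rp_gt0 q)).
case: ifP => _; first by rewrite !lp_sqr; field; rewrite ?lu ?lv ?ru ?rv.
case: ifP => _; first by rewrite !rp_sqr; field; rewrite ?lu ?lv ?ru ?rv.
case: eqP => [->|]; last by rewrite mulr0 mul0r.
rewrite mulrAC divff ?mul1r // /loop_weight.
by case: ifP => _; [|case: ifP => _]; rewrite ?addr0 //; field.
Qed.

Lemma edge_cls_neq u v : dc_edge u v -> (cls u == cls v) = false.
Proof.
by rewrite -qedge_cls => uv; apply/eqP => e; move: uv; rewrite e qedge_cls edge_irr.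
Qed.

Variant edge_spec u v : Prop :=
| EdgeSpec of dc_edge u v & dc_edge v u = false & dc_sign v u = 1
| EdgeSpecN of dc_edge u v & dc_edge v u = false & dc_sign v u = -1
| NoEdgeSpec of dc_edge u v = false.

Lemma edge_specP u v : edge_spec u v.
Proof.
case uv: (dc_edge u v); last exact: NoEdgeSpec.
by case: (dc_signP uv); [apply: EdgeSpec | apply: EdgeSpecN];
  rewrite ?(edge_asym uv).
Qed.

(** Swapping the arguments exchanges the signs under which an edge contributes, and negating one end
    does the same; the weight depends only on the edge of the quotient. *)
Lemma AG_entry_negl u v : AG_entry (dc_neg u) v = AG_entry v u.
Proof.
rewrite /AG_entry !cls_neg edge_negl edge_negr [cls v == _]eq_sym.
case: (edge_specP u v) => [e e' s|e e' s|e'].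
- by rewrite e e' /= (dc_sign_negr e) s.
- by rewrite e e' /= (dc_sign_negr e) s opprK (edge_cls_neq e).
case: (edge_specP v u) => [e _ s|e _ s|e].
- by rewrite e e' /= (dc_sign_negl e) s [cls u == _]eq_sym (edge_cls_neq e).
- by rewrite e e' /= (dc_sign_negl e) s opprK.
by rewrite e e' /=; case: eqP => [->|].
Qed.

Lemma AG_entry_negr u v : AG_entry u (dc_neg v) = AG_entry v u.
Proof. by rewrite -AG_entry_negl dc_negK. Qed.

(** Between adjacent classes exactly one of [v] and [-v] has the contributing sign, with the full
    edge weight; within a class both contribute a loop weight. *)
Lemma AG_entry_sum u v :
  AG_entry u v + AG_entry u (dc_neg v) = AQ_entry (cls u) (cls v).
Proof.
rewrite AG_entry_negr /AG_entry /AQ_entry !qedge_cls [cls v == _]eq_sym.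
case: (edge_specP u v) => [e e' s|e e' s|e'].
- by rewrite e e' /= s (edge_cls_neq e) add0r.
- by rewrite e e' /= s (edge_cls_neq e) addr0.
case: (edge_specP v u) => [e _ s|e _ s|e].
- by rewrite e e' /= s [cls u == _]eq_sym (edge_cls_neq e) addr0.
- by rewrite e e' /= s [cls u == _]eq_sym (edge_cls_neq e) add0r.
by rewrite e e' /=; case: eqP => [->|]; rewrite ?addr0.
Qed.

End Entries.

(** * Even and odd functions as images of signed incidence matrices *)

Section SignedIncidence.
Variables (K : numFieldType) (G : doubleCover).
Implicit Types (b : G -> bool) (s : bool).

Definition Fsgn s : {vspace 'cV[K]_#|G|} := if s then Falt K G else Fsym K G.

Lemma mem_Fsgn s (f : 'cV[K]_#|G|) :
  (f \in Fsgn s) = (negmx K G *m f == (-1) ^+ s *: f).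
Proof.
case: s; rewrite /Fsgn memv_ker lfunE /=.
  by rewrite mulmxDl mul1mx addr_eq0 expr1 scaleN1r.
by rewrite mulmxBl mul1mx subr_eq0 scale1r.
Qed.

Lemma mul_negmx (T : finType) (F : G -> T -> K) :
  negmx K G *m mx_of F = mx_of (fun u v => F (dc_neg u) v).
Proof.
rewrite mulmx_of; apply: eq_mx_of => u v.
rewrite (bigD1 (dc_neg u)) //= eqxx mul1r big1 ?addr0 // => w /negPf ->.
by rewrite mul0r.
Qed.

Lemma mul_mx_neg (T : finType) (F : T -> G -> K) :
  mx_of F *m negmx K G = mx_of (fun u v => F u (dc_neg v)).
Proof.
rewrite mulmx_of; apply: eq_mx_of => u v.
rewrite (bigD1 (dc_neg v)) //= dc_negK eqxx mulr1 big1 ?addr0 // => w.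
by rewrite eq_neg eq_sym => /negPf ->; rewrite mulr0.
Qed.

Lemma negmx_sqr : negmx K G *m negmx K G = 1%:M.
Proof.
rewrite mul_negmx -mx_of1; apply: eq_mx_of => u v.
by rewrite dc_negK eq_sym.
Qed.

(** The matrix M of the lift of functions from the quotient with sign (-1)^b: constant [false] gives
    the pullback, [orient_sign] the odd extension. *)
Definition inc_mx b : 'M[K]_(#|G|, #|qnode G|) :=
  mx_of (fun u p => if cls u == p then (-1) ^+ b u else 0).

Lemma inc_mxE b (g : 'cV[K]_#|qnode G|) :
  inc_mx b *m g = col_of (fun u => (-1) ^+ b u * at_ g (cls u)).
Proof.
rewrite mulmx_col_of; apply/colP => i; rewrite !mxE.
rewrite (bigD1 (cls (enum_val i))) //= eqxx big1 ?addr0 // => p.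
by rewrite eq_sym => /negPf ->; rewrite mul0r.
Qed.

(** Columns have disjoint supports, each a class of two nodes with entries 1 or -1. *)
Lemma tr_inc_mul b : (inc_mx b)^T *m inc_mx b = 2%:M.
Proof.
rewrite tr_mx_of mulmx_of -scalemx1 -mx_of1.
apply/matrixP => i j; rewrite !mxE.
set p := enum_val i; set q := enum_val j; have [v pv] := clsP p.
rewrite (bigID (fun u => cls u == p)) /= addrC big1 ?add0r; last first.
  by move=> u /negPf ->; rewrite mul0r.
rewrite pv sum_cls cls_neg eqxx; case: ifP => _; last by rewrite !mulr0 addr0.
by rewrite -!expr2 !sqrr_sign mulr1.
Qed.

Section Parity.
Variables (b : G -> bool) (s : bool).
Hypothesis b_neg : forall u, b (dc_neg u) = b u (+) s.

Lemma negmx_inc : negmx K G *m inc_mx b = (-1) ^+ s *: inc_mx b.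
Proof.
rewrite mul_negmx; apply/matrixP => i j; rewrite !mxE cls_neg b_neg signr_addb.
by case: eqP; rewrite ?mulr0 // mulrC.
Qed.

(** Rows [u] and [v] overlap only within a class: v = u gives 1, and v = -u gives (-1)^s. *)
Lemma inc_mul_tr : inc_mx b *m (inc_mx b)^T = 1%:M + (-1) ^+ s *: negmx K G.
Proof.
rewrite tr_mx_of mulmx_of -mx_of1; apply/matrixP => i j; rewrite !mxE.
set u := enum_val i; set v := enum_val j.
rewrite (bigD1 (cls u)) //= eqxx big1 ?addr0; last first.
  by move=> p; rewrite eq_sym => /negPf ->; rewrite mul0r.
rewrite [cls v == _]eq_sym cls_eq [v == dc_neg u]eq_sym -eq_neg.
have [->|uv] /= := eqVneq u v.
  by rewrite [v == _]eq_sym (negPf (dc_neg_neq v)) mulr0 addr0 -expr2 sqrr_sign.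
case: eqP => [->|_]; last by rewrite !mulr0 addr0.
by rewrite b_neg signr_addb mulrAC -expr2 sqrr_sign mul1r mulr1 add0r.
Qed.

(** M M^T / 2 = (1 + (-1)^s N) / 2 is the projection onto the functions of parity [s], which are
    therefore its fixed vectors. *)
Lemma mem_Fsgn_inc (f : 'cV[K]_#|G|) :
  (f \in Fsgn s) = (inc_mx b *m (2^-1 *: (inc_mx b)^T *m f) == f).
Proof.
rewrite mem_Fsgn -scalemxAl -scalemxAr mulmxA inc_mul_tr mulmxDl mul1mx.
rewrite -scalemxAl; have n2 : 2 != 0 :> K by rewrite pnatr_eq0.
rewrite -[RHS](inj_eq (scalerI n2)) scalerA mulfV // scale1r.
rewrite (scaler_nat 2 f) mulr2n (inj_eq (addrI f)).
rewrite -[RHS](inj_eq (scalerI (_ : (-1) ^+ s != 0))) ?signr_eq0 //.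
by rewrite scalerA -expr2 sqrr_sign scale1r.
Qed.

Lemma inc_mx_Fsgn (g : 'cV[K]_#|qnode G|) : inc_mx b *m g \in Fsgn s.
Proof. by rewrite mem_Fsgn mulmxA negmx_inc scalemxAl. Qed.

End Parity.

Lemma inc_mx_eq0 b (g : 'cV[K]_#|qnode G|) : (inc_mx b *m g == 0) = (g == 0).
Proof.
apply/eqP/eqP => [e|->]; last by rewrite mulmx0.
have := congr1 (mulmx (inc_mx b)^T) e.
rewrite mulmxA tr_inc_mul mulmx0 mul_scalar_mx => /eqP.
by rewrite scaler_eq0 pnatr_eq0 => /eqP.
Qed.

Lemma pullbackE (g : 'cV[K]_#|qnode G|) :
  pullback g = inc_mx (fun _ => false) *m g.
Proof. by rewrite inc_mxE; apply/colP => i; rewrite !mxE mul1r. Qed.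

Definition orient_sign (O : qnode G -> G) (u : G) : bool := u != O (cls u).

Lemma odd_extE O (g : 'cV[K]_#|qnode G|) :
  odd_ext O g = inc_mx (orient_sign O) *m g.
Proof.
rewrite inc_mxE; apply/colP => i; rewrite !mxE /orient_sign.
by case: eqP; rewrite ?mul1r ?mulN1r.
Qed.

End SignedIncidence.

(** An orientation chooses exactly one of [u] and [-u]. *)
Lemma orient_sign_neg (G : doubleCover) (O : qnode G -> G) :
  is_orientation O ->
  forall u, orient_sign O (dc_neg u) = orient_sign O u (+) true.
Proof.
move=> hO u; rewrite /orient_sign cls_neg addbT negbK.
have := hO (cls u); rewrite mem_cls cls_eq => /orP[] /eqP ->.
  by rewrite eqxx (negPf (dc_neg_neq u)).
by rewrite eqxx [u == _]eq_sym (negPf (dc_neg_neq u)).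
Qed.

Lemma map_negmx (R : realType) (G : doubleCover) :
  cplx (negmx R G) = negmx R[i] G.
Proof.
by apply/matrixP => i j; rewrite !mxE; case: eqP => _; rewrite ?rmorph1 ?rmorph0.
Qed.

Lemma map_inc_mx (R : realType) (G : doubleCover) b :
  cplx (inc_mx R b) = inc_mx R[i] b :> 'M_(#|G|, _).
Proof.
by apply/matrixP => i j; rewrite !mxE; case: eqP => _; rewrite ?rmorph_sign ?rmorph0.
Qed.

(** * Splitting of [AG] by parity, and its quotient matrices *)

Section Decomposition.
Variables (R : realType) (G : doubleCover).
Local Notation A := (AG R G).
Local Notation N := (negmx R G).

Lemma AG_tr : A^T = A *m N.
Proof.
rewrite AGE tr_mx_of mul_mx_neg; apply: eq_mx_of => u v.
by rewrite AG_entry_negr.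
Qed.

Lemma AG_negmxC : N *m A = A *m N.
Proof.
rewrite AGE mul_negmx mul_mx_neg; apply: eq_mx_of => u v.
by rewrite AG_entry_negl AG_entry_negr.
Qed.

Definition AGsgn (s : bool) : 'M[R]_#|G| := 2^-1 *: (A + (-1) ^+ s *: A^T).

Lemma AGsgn_false : AGsgn false = AGsym R G.
Proof. by rewrite /AGsgn scale1r. Qed.

Lemma AGsgn_true : AGsgn true = AGalt R G.
Proof. by rewrite /AGsgn expr1 scaleN1r. Qed.

Lemma AGsgn_tr s : (AGsgn s)^T = (-1) ^+ s *: AGsgn s.
Proof.
rewrite /AGsgn linearZ /= linearD /= linearZ /= trmxK [RHS]scalerA mulrC.
rewrite -scalerA; congr (_ *: _).
by rewrite scalerDr scalerA -expr2 sqrr_sign scale1r addrC.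
Qed.

Lemma AGsgnE s : AGsgn s = 2^-1 *: (A *m (1%:M + (-1) ^+ s *: N)).
Proof. by rewrite /AGsgn AG_tr mulmxDr mulmx1 scalemxAr. Qed.

(** On functions of parity [s], N acts as (-1)^s, so (1 + (-1)^s N) / 2 acts as the identity.
    Complex functions are needed for nonreal eigenvalues. *)
Lemma cplx_AGsgn_Fsgn s (f : 'cV[R[i]]_#|G|) :
  f \in Fsgn _ G s -> cplx (AGsgn s) *m f = cplx A *m f.
Proof.
rewrite mem_Fsgn AGsgnE => /eqP fN; rewrite /cplx map_mxZ map_mxM map_mxD.
rewrite map_mxZ map_scalar_mx rmorph1 rmorph_sign -/(cplx N) map_negmx.
rewrite -scalemxAl -mulmxA mulmxDl mul1mx -scalemxAl fN scalerA -expr2.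
rewrite sqrr_sign scale1r -mulr2n -scaler_nat -scalemxAr scalerA fmorphV rmorph_nat.
by rewrite mulVf ?pnatr_eq0 // scale1r.
Qed.

Lemma AGsgn_Fsgn s (f : 'cV[R]_#|G|) :
  f \in Fsgn _ G s -> AGsgn s *m f = A *m f.
Proof.
rewrite mem_Fsgn AGsgnE => /eqP fN.
rewrite -scalemxAl -mulmxA mulmxDl mul1mx -scalemxAl fN scalerA -expr2.
rewrite sqrr_sign scale1r -mulr2n -scaler_nat -scalemxAr scalerA.
by rewrite mulVf ?pnatr_eq0 // scale1r.
Qed.

Lemma AGsgn_Fsgn_stable s (f : 'cV[R]_#|G|) :
  f \in Fsgn _ G s -> AGsgn s *m f \in Fsgn _ G s.
Proof.
move=> fF; rewrite AGsgn_Fsgn // mem_Fsgn mulmxA AG_negmxC -mulmxA.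
by move: fF; rewrite mem_Fsgn => /eqP ->; rewrite scalemxAr.
Qed.

(** On the opposite parity the factor 1 + (-1)^s N vanishes. *)
Lemma AGsgn_Fsgn_opp s (f : 'cV[R]_#|G|) :
  f \in Fsgn _ G (~~ s) -> AGsgn s *m f = 0.
Proof.
rewrite mem_Fsgn AGsgnE => /eqP fN.
rewrite -scalemxAl -mulmxA mulmxDl mul1mx -scalemxAl fN scalerA -signr_addb.
by rewrite addbN addbb expr1 scaleN1r subrr mulmx0 scaler0.
Qed.

Lemma eigenfun_AGsgn s (l : R[i]) f : f \in Fsgn _ G s ->
  eigenfun (cplx (AGsgn s)) l f -> eigenfun (cplx A) l f.
Proof. by move=> fF [f0 e]; split=> //; rewrite -(cplx_AGsgn_Fsgn fF). Qed.

Lemma dot_AGsgn s (f g : 'cV[R]_#|G|) :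
  dot (AGsgn s *m f) g = (-1) ^+ s * dot f (AGsgn s *m g).
Proof.
have dotE (x y : 'cV[R]_#|G|) : dot x y = (x^T *m y) 0 0.
  by rewrite mxE; apply: eq_bigr => i _; rewrite mxE.
by rewrite !dotE trmx_mul AGsgn_tr -scalemxAr -scalemxAl mulmxA mxE.
Qed.

Definition AGquo (b : G -> bool) : 'M[R]_#|qnode G| :=
  2^-1 *: ((inc_mx R b)^T *m A *m inc_mx R b).

Section Parity.
Variables (b : G -> bool) (s : bool).
Hypothesis b_neg : forall u, b (dc_neg u) = b u (+) s.
Local Notation M := (inc_mx R b).
Local Notation B := (AGquo b).

(** M M^T A M = (1 + (-1)^s N) A M = A (1 + (-1)^s N) M = 2 A M. *)
Lemma AG_inc : A *m M = M *m B.
Proof.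
rewrite /AGquo -scalemxAr (mulmxA M (_ *m A)) (mulmxA M).
rewrite (inc_mul_tr _ b_neg) mulmxDl mul1mx.
rewrite -scalemxAl AG_negmxC mulmxDl -scalemxAl -(mulmxA A) (negmx_inc _ b_neg).
rewrite -scalemxAr scalerA -expr2 sqrr_sign scale1r -mulr2n -scaler_nat scalerA.
by rewrite mulVf ?pnatr_eq0 // scale1r.
Qed.

Lemma AGsgn_inc : AGsgn s *m M = M *m B.
Proof.
rewrite -AG_inc AGsgnE -scalemxAl -mulmxA mulmxDl mul1mx -scalemxAl.
rewrite (negmx_inc _ b_neg) scalerA -expr2 sqrr_sign scale1r -mulr2n -scaler_nat.
by rewrite -scalemxAr scalerA mulVf ?pnatr_eq0 // scale1r.
Qed.

(** 2 B^T = M^T A^T M = M^T A N M = (-1)^s M^T A M. *)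
Lemma AGquo_tr : B^T = (-1) ^+ s *: B.
Proof.
rewrite /AGquo linearZ /= trmx_mul (trmx_mul _ A) trmxK AG_tr.
rewrite -(mulmxA A) (negmx_inc _ b_neg).
by rewrite -!scalemxAr mulmxA scalerA mulrC -scalerA.
Qed.

Lemma mxsim_restr_AGsgn : mxsim (restr (AGsgn s) (Fsgn R G s)) B.
Proof.
apply: (mxsim_restr (M := M) (L := 2^-1 *: M^T)).
- rewrite -scalemxAl tr_inc_mul -scalemx1 scalerA mulVf ?pnatr_eq0 //.
  by rewrite scale1r.
- exact: AGsgn_inc.
- by move=> f; exact: mem_Fsgn_inc.
Qed.

Lemma eigenfun_inc (l : R[i]) g : eigenfun (cplx B) l g ->
  inc_mx R[i] b *m g \in Fsgn _ G s /\
  eigenfun (cplx (AGsgn s)) l (inc_mx R[i] b *m g).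
Proof.
case=> g0 e; split; first exact: inc_mx_Fsgn.
split; first by rewrite inc_mx_eq0.
by rewrite -map_inc_mx mulmxA -cplxM AGsgn_inc cplxM -mulmxA e scalemxAr.
Qed.

End Parity.

(** Even and odd lifts side by side form an invertible matrix that conjugates A to the block
    diagonal matrix of the two quotients. *)
Lemma char_poly_AG (b0 b1 : G -> bool) :
  (forall u, b0 (dc_neg u) = b0 u (+) false) ->
  (forall u, b1 (dc_neg u) = b1 u (+) true) ->
  char_poly A = char_poly (AGquo b0) * char_poly (AGquo b1).
Proof.
move=> h0 h1; rewrite -char_poly_block_diag; apply: mxsim_char_poly.
set M0 := inc_mx R b0; set M1 := inc_mx R b1.
(* Even and odd columns are orthogonal: inserting N N = 1 and moving one N to each side changes the
   sign of the product. *)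
have MM0 : M0^T *m M1 = 0.
  have e : M0^T *m M1 = - (M0^T *m M1).
    rewrite -{1}[M1]mul1mx -(negmx_sqr R G) -(mulmxA N) (negmx_inc _ h1).
    rewrite expr1 scaleN1r mulmxN mulmxN mulmxA; congr (- (_ *m _)).
    have Nt : N^T = N.
      rewrite tr_mx_of; apply: eq_mx_of => u v.
      by rewrite eq_neg [_ == v]eq_sym.
    by rewrite -Nt -trmx_mul (negmx_inc _ h0) scale1r.
  apply/eqP; have /eqP := e; rewrite -addr_eq0 -mulr2n -scaler_nat scaler_eq0.
  by rewrite pnatr_eq0.
have n2 : 2^-1 * 2 = 1 :> R by rewrite mulVf ?pnatr_eq0.
(* The inverse is half the transpose, since (1 + N) + (1 - N) = 2. *)
exists (row_mx M0 M1), (2^-1 *: (row_mx M0 M1)^T); split.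
- rewrite -scalemxAr tr_row_mx mul_row_col (inc_mul_tr _ h0) (inc_mul_tr _ h1).
  rewrite scale1r expr1 scaleN1r addrACA subrr addr0 -mulr2n -scaler_nat scalerA.
  by rewrite n2 scale1r.
- rewrite -scalemxAl tr_row_mx mul_col_row !tr_inc_mul MM0.
  have -> : M1^T *m M0 = 0 by rewrite -[LHS]trmxK trmx_mul trmxK MM0 trmx0.
  by rewrite -scalar_mx_block scale_scalar_mx n2.
- rewrite mul_mx_row mul_row_block !mulmx0 addr0 add0r.
  by rewrite (AG_inc h0) (AG_inc h1).
Qed.

(** Summing a row of A over a class gives A M = M [AQ]; multiplying by M^T / 2 isolates [AQ]. *)
Lemma AQ_AGquo : AQ R G = AGquo (fun=> false).
Proof.
have AM : A *m inc_mx R (fun=> false) = inc_mx R (fun=> false) *m AQ R G.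
  rewrite AGE AQE !mulmx_of; apply: eq_mx_of => u p.
  rewrite (bigD1 (cls u)) //= eqxx mul1r [X in _ + X]big1 ?addr0; last first.
    by move=> q; rewrite eq_sym => /negPf ->; rewrite mul0r.
  have [v ->] := clsP p; rewrite -AG_entry_sum -sum_cls.
  rewrite [RHS]big_mkcond; apply: eq_bigr => w _.
  by case: eqP; rewrite ?mulr1 ?mulr0.
rewrite /AGquo -mulmxA AM mulmxA tr_inc_mul mul_scalar_mx scalerA.
by rewrite mulVf ?pnatr_eq0 // scale1r.
Qed.

Lemma AO_AGquo (O : qnode G -> G) :
  is_orientation O -> AO R O = AGquo (orient_sign O).
Proof.
move=> hO; rewrite /AO /AGquo.
(* Row p of [Qalt] is supported on the class p, with the signs of the odd extension. *)
suff -> : Qalt R O = (inc_mx R (orient_sign O))^T by rewrite trmxK.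
rewrite tr_mx_of; apply: eq_mx_of => p u; rewrite /orient_sign.
have : cls (O p) == p by rewrite -mem_cls.
have [<- /eqP e|ne /eqP e] := eqVneq (O p) u; first by rewrite e !eqxx.
have [e'|ne'] := eqVneq (O p) (dc_neg u).
  have up : cls u = p by rewrite -e e' cls_neg.
  by rewrite up eqxx eq_sym ne expr1.
by rewrite -{1}e [cls u == _]eq_sym cls_eq (negPf ne) (negPf ne').
Qed.

End Decomposition.

(** * Assembly of the four claims, with [s] false for even and true for odd functions *)

Theorem theorem1p42 (R : realType) (G : doubleCover) (O : qnode G -> G)
    (hO : is_orientation O) :
  (* (1) *)
  [/\ forall f, f \in Fsym R G -> AGsym R G *m f \in Fsym R G,
      forall f, f \in Falt R G -> AGsym R G *m f = 0,
      forall f, f \in Falt R G -> AGalt R G *m f \in Falt R G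
    & forall f, f \in Fsym R G -> AGalt R G *m f = 0]
  /\
  (* (2) *)
  [/\ perm_eq (Sp (AG R G))
        (Sp (restr (AGsym R G) (Fsym R G)) ++ Sp (restr (AGalt R G) (Falt R G))),
      forall (l : R[i]) f, f \in Fsym R[i] G ->
        eigenfun (cplx (AGsym R G)) l f -> eigenfun (cplx (AG R G)) l f
    & forall (l : R[i]) f, f \in Falt R[i] G ->
        eigenfun (cplx (AGalt R G)) l f -> eigenfun (cplx (AG R G)) l f]
  /\
  (* (3) *)
  ([/\ forall f g, f \in Fsym R G -> g \in Fsym R G ->
         dot (AGsym R G *m f) g = dot f (AGsym R G *m g),
       mxpoly.diagonalizable (restr (AGsym R G) (Fsym R G))
     & forall l, l \in Sp (restr (AGsym R G) (Fsym R G)) -> complex.Im l = 0]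
   /\
   [/\ forall f g, f \in Falt R G -> g \in Falt R G ->
         dot (AGalt R G *m f) g = - dot f (AGalt R G *m g),
       mxpoly.diagonalizable (cplx (restr (AGalt R G) (Falt R G)))
     & forall l, l \in Sp (restr (AGalt R G) (Falt R G)) -> complex.Re l = 0])
  /\
  (* (4) *)
  ([/\ perm_eq (Sp (restr (AGsym R G) (Fsym R G))) (Sp (AQ R G))
     & forall (l : R[i]) g, eigenfun (cplx (AQ R G)) l g ->
         pullback g \in Fsym R[i] G /\
         eigenfun (cplx (AGsym R G)) l (pullback g)]
   /\
   [/\ perm_eq (Sp (restr (AGalt R G) (Falt R G))) (Sp (AO R O))
     & forall (l : R[i]) g, eigenfun (cplx (AO R O)) l g ->
         odd_ext O g \in Falt R[i] G /\
         eigenfun (cplx (AGalt R G)) l (odd_ext O g)]).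
Proof.
have b0 (u : G) : false = false (+) false by [].
have b1 := orient_sign_neg hO.
have sim0 := mxsim_restr_AGsgn R b0.
(* These two similarities carry the claims on spectra and diagonalizability over to the quotient
   matrices. *)
have sim1 := mxsim_restr_AGsgn R b1.
have cp0 := mxsim_char_poly sim0.
have cp1 := mxsim_char_poly sim1.
have tr0 : (AGquo R (fun _ : G => false))^T = AGquo R (fun=> false).
  by rewrite (AGquo_tr R b0) scale1r.
have tr1 := AGquo_tr R b1.
rewrite (AO_AGquo R hO) AQ_AGquo -AGsgn_false -AGsgn_true.
rewrite -[Fsym R G]/(Fsgn R G false) -[Falt R G]/(Fsgn R G true).
rewrite -[Fsym R[i] G]/(Fsgn R[i] G false) -[Falt R[i] G]/(Fsgn R[i] G true).
split; [split|split; [split|split; [split; split|split; split]]].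
- by move=> f; exact: AGsgn_Fsgn_stable.
- by move=> f; exact: (@AGsgn_Fsgn_opp _ _ false).
- by move=> f; exact: AGsgn_Fsgn_stable.
- by move=> f; exact: (@AGsgn_Fsgn_opp _ _ true).
- by apply: Sp_cat; rewrite (char_poly_AG R b0 b1) cp0 cp1.
- by move=> l f; exact: eigenfun_AGsgn.
- by move=> l f; exact: eigenfun_AGsgn.
- by move=> f g _ _; rewrite dot_AGsgn mul1r.
- exact: mxsim_diagonalizable sim0 (symmetric_diagonalizable tr0).
- move=> l; rewrite (perm_mem (Sp_perm_eq cp0)) mem_Sp.
  move=> /(sgn_sym_eigenvalue (AGquo_tr R b0)); rewrite mul1r.
  exact: conjC_Im0.
- by move=> f g _ _; rewrite dot_AGsgn mulN1r.
- exact: mxsim_diagonalizable (mxsim_cplx sim1) (sgn_sym_diagonalizable tr1).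
- move=> l; rewrite (perm_mem (Sp_perm_eq cp1)) mem_Sp.
  move=> /(sgn_sym_eigenvalue tr1); rewrite mulN1r.
  exact: conjC_Re0.
- exact: Sp_perm_eq.
- by move=> l g; rewrite pullbackE; exact: eigenfun_inc.
- exact: Sp_perm_eq.
- by move=> l g; rewrite odd_extE; exact: eigenfun_inc.
Qed.
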